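(* Let $\alpha=(\alpha_1,\dots,\alpha_\ell)$ be a strong composition. Then the key polynomial $\kappa_\alpha$ is multiplicity free (in its expansion into fundamental slide polynomials) if and only if $\alpha$ satisfies all three of the following conditions: (a) there are no indices $i<j<k$ such that $\alpha_i<\alpha_j<\alpha_k$; (b) there are no indices $i<j<k<l$ such that $\alpha_i<\alpha_l$, $\alpha_j<\alpha_l$ and $\alpha_l<\alpha_k$; (c) there are no indices $i<j<k<l$ such that $\alpha_i<\alpha_k$, $\alpha_j+1<\alpha_k$ and $\alpha_k=\alpha_l$.
   Context: A weak composition $a=(a_1,\dots,a_\ell)$ of length $\ell$ is a finite sequence of nonnegative integers; a strong composition is one whose parts are all positive. A diagram is a finite set of cells $(r,c)$ with $r,c$ positive integers, the cell $(r,c)$ lying in row $r$ (counted from the bottom) and column $c$ (counted from the left). A Kohnert tableau of content $a$ is a diagram whose cells are filled with positive integers, with exactly $a_i$ cells containing $i$ for each $i$, such that: (i) for each $i$ there is exactly one $i$ in each of the columns $1,\dots,a_i$; (ii) every entry in row $r$ is at least $r$; (iii) for each $i$, the cells containing $i$ weakly descend (their row index weakly decreases) from left to right; (iv) if $i<j$ appear in the same column with $i$ above $j$, then there is an $i$ in the column immediately to the right of the cell containing that $j$, in a row strictly above it. It is quasi-Yamanouchi if moreover (v) for each nonempty row $r$, either row $r$ contains an entry equal to $r$, or some cell of row $r+1$ lies weakly to the right of some cell of row $r$. Let $\mathrm{QKT}(a)$ be the set of quasi-Yamanouchi Kohnert tableaux of content $a$, and for a tableau $T$ let $\mathrm{wt}(T)$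 be the weak composition of length $\ell$ whose $r$-th part is the number of cells in row $r$ of $T$. For weak compositions $a,b$ of length $\ell$, $b$ dominates $a$ if $b_1+\dots+b_i\ge a_1+\dots+a_i$ for all $i$; $\mathrm{flat}(a)$ is the strong composition obtained by deleting the zeros of $a$; a strong composition $\beta$ refines a strong composition $\alpha$ if $\alpha$ is obtained by summing consecutive blocks of parts of $\beta$. The fundamental slide polynomial is $\mathfrak{F}_a=\sum x^b$ over weak compositions $b$ of length $\ell$ dominating $a$ with $\mathrm{flat}(b)$ refining $\mathrm{flat}(a)$, where $x^b=x_1^{b_1}\cdots x_\ell^{b_\ell}$. The key polynomial is $\kappa_a=\sum_T x^{\mathrm{wt}(T)}$ over all Kohnert tableaux $T$ of content $a$; it satisfies $\kappa_a=\sum_{T\in\mathrm{QKT}(a)}\mathfrak{F}_{\mathrm{wt}(T)}$. We say $\kappa_a$ is multiplicity free if distinct tableaux in $\mathrm{QKT}(a)$ have distinct weights. *)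

(* Defs.v *)
From mathcomp Require Import all_boot finmap.

Set Implicit Arguments.
Unset Strict Implicit.
Unset Printing Implicit Defensive.

(* Parts are numbered from 1, as rows, columns and entries are. The value is 0
   for i = 0 and for i > size a, so that only 1, ..., size a can be entries of
   a tableau of content a. *)
Definition part (a : seq nat) (i : nat) : nat := nth 0 (0 :: a) i.

Definition strong_comp (a : seq nat) : bool := all (fun p => 0 < p) a.

(* A cell is a pair (row, column); the domain of a filling is its diagram. *)
Definition filling := {fmap nat * nat -> nat}.

Definition entry (T : filling) (r c i : nat) : Prop := T.[? (r, c)]%fmap = Some i.

Definition cell_in (T : filling) (r c : nat) : Prop := (r, c) \in domf T.

Definition count_entry (T : filling) (i : nat) : nat :=
  #|` [fset x in domf T | (T.[? x]%fmap == Some i)]%fset |.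

Definition count_row (T : filling) (r : nat) : nat :=
  #|` [fset x in domf T | x.1 == r]%fset |.

Record kohnert_tableau (a : seq nat) (T : filling) : Prop := KohnertTableau {
  kt_cells : forall r c, cell_in T r c -> 0 < r /\ 0 < c;
  kt_entries : forall r c i, entry T r c i -> 0 < i;
  kt_content : forall i, 0 < i -> count_entry T i = part a i;
  kt_columns : forall i c, 0 < i -> 1 <= c <= part a i ->
    exists! r, entry T r c i;
  kt_flag : forall r c i, entry T r c i -> r <= i;
  kt_descend : forall i r c r' c', entry T r c i -> entry T r' c' i ->
    c < c' -> r' <= r;
  kt_inversion : forall i j r r' c, i < j -> entry T r c i -> entry T r' c j ->
    r' < r -> exists2 r'', r' < r'' & entry T r'' c.+1 i
}.

Definition quasi_yamanouchi (T : filling) : Prop :=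
  forall r, (exists c, cell_in T r c) ->
    (exists c, entry T r c r) \/
    (exists c c', [/\ cell_in T r c, cell_in T r.+1 c' & c <= c']).

Definition QKT (a : seq nat) (T : filling) : Prop :=
  kohnert_tableau a T /\ quasi_yamanouchi T.

Definition wt (a : seq nat) (T : filling) : seq nat :=
  [seq count_row T r | r <- iota 1 (size a)].

(* The expansion of the key polynomial of a into fundamental slide polynomials
   is the sum of the slide polynomials of wt a T over T in QKT a. *)
Definition key_multiplicity_free (a : seq nat) : Prop :=
  forall T U : filling, QKT a T -> QKT a U -> wt a T = wt a U -> T = U.

(* Main.v *)
Require Import Defs.
From mathcomp Require Import all_boot finmap zify.

(* As alpha is strong, column 1 of a Kohnert tableau is the identity, so that
   every Kohnert tableau is quasi-Yamanouchi. A tableau is determined by its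
   diagram, so the question is whether two diagrams can have the same numbers
   of cells in their rows.
   If they do, consider the topmost row r in which they differ, and two columns
   c < c' whose cells of row r belong to the one and to the other diagram.
   Counting cells of rows 1, ..., r in these columns exhibits a pattern
   forbidden by (a), (b) or (c).
   Conversely, any injective assignment of rows to the entries of each column
   in which entries do not rise above their own row and descend weakly can be
   straightened into a Kohnert tableau with the same diagram. In each pattern
   there are two such assignments that differ by exchanging the rows of two
   entries of distinct columns: their weights agree, their diagrams do not. *)

Set Implicit Arguments.
Unset Strict Implicit.
Unset Printing Implicit Defensive.

(** * Entries of a Kohnert tableau and its recovery from the diagram *)

Lemma part_gt0_size (a : seq nat) (i : nat) :
  0 < part a i -> 0 < i /\ i <= size a.
Proof.
rewrite /part; case: i => [|i] //= h.
by split=> //; rewrite ltnNge; apply/negP => hi; rewrite nth_default in h.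
Qed.

Lemma entry_cell (T : filling) (r c i : nat) : entry T r c i -> cell_in T r c.
Proof.
rewrite /entry /cell_in => h; apply/negPn/negP => hn.
by rewrite not_fnd in h.
Qed.

Lemma cell_entry (T : filling) (r c : nat) :
  cell_in T r c -> exists i, entry T r c i.
Proof. by move=> h; exists T.[h]%fmap; rewrite /entry in_fnd. Qed.

Lemma entry_inj (T : filling) (r c i j : nat) :
  entry T r c i -> entry T r c j -> i = j.
Proof. by rewrite /entry => -> [->]. Qed.

(** Columns 1, ..., [part a i] already account for all the cells containing [i]; a cell in any
    further column would be one too many. *)
Lemma entry_column (a : seq nat) (T : filling) (r c i : nat) :
  kohnert_tableau a T -> entry T r c i -> 0 < c <= part a i.
Proof.
move=> kT e; have [r0 c0] := kt_cells kT (entry_cell e).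
have i0 := kt_entries kT e.
rewrite c0 leqNgt; apply/negP => hc.
pose A := [fset x in domf T | T.[? x]%fmap == Some i]%fset.
have inA r' c' : entry T r' c' i -> (r', c') \in A.
  by move=> e'; rewrite !inE /= (entry_cell e') /=; apply/eqP.
have : size (rcons (iota 1 (part a i)) c) <= size (map snd A).
  apply: uniq_leq_size.
    by rewrite rcons_uniq iota_uniq mem_iota andbT; lia.
  move=> d; rewrite mem_rcons inE mem_iota => /orP [/eqP ->|hd].
    by apply/mapP; exists (r, c) => //; apply: inA.
  have [|r' [e' _]] := kt_columns kT (c := d) i0; first by lia.
  by apply/mapP; exists (r', d) => //; apply: inA.
rewrite size_rcons size_iota size_map.
by have := kt_content kT i0; rewrite /count_entry => <-; rewrite ltnn.
Qed.

Lemma entry_range (a : seq nat) (T : filling) (r c i : nat) :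
  kohnert_tableau a T -> entry T r c i ->
  [/\ 0 < r, r <= i, i <= size a & 0 < c <= part a i].
Proof.
move=> kT e; have hc := entry_column kT e.
have [|_ hi] := @part_gt0_size a i; first by lia.
by have [r0 _] := kt_cells kT (entry_cell e); split=> //; exact: (kt_flag kT e).
Qed.

Lemma entry_row_inj (a : seq nat) (T : filling) (r r' c i : nat) :
  kohnert_tableau a T -> entry T r c i -> entry T r' c i -> r = r'.
Proof.
move=> kT e e'; have i0 := kt_entries kT e.
have [r'' [_ h]] := kt_columns kT i0 (entry_column kT e).
by rewrite -(h _ e) (h _ e').
Qed.

Lemma entry_exists (a : seq nat) (T : filling) (c i : nat) :
  kohnert_tableau a T -> 0 < c <= part a i -> exists r, entry T r c i.
Proof.
move=> kT hc; have [|i0 _] := @part_gt0_size a i; first by lia.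
by have [r [e _]] := kt_columns kT i0 hc; exists r.
Qed.

(* Reading columns from right to left and each of them from bottom to top, a
   cell carries the least entry available there. *)
Lemma label_not_lt (a : seq nat) (T U : filling) (r c i j : nat) :
  kohnert_tableau a T -> kohnert_tableau a U ->
  (forall p, T.[? (p, c.+1)]%fmap = U.[? (p, c.+1)]%fmap) ->
  (forall p, p < r -> T.[? (p, c)]%fmap = U.[? (p, c)]%fmap) ->
  entry T r c i -> entry U r c j -> ~ i < j.
Proof.
move=> kT kU hc hr eT eU ij.
have [p eUp] := entry_exists kU (entry_column kT eT).
case: (ltngtP p r) => [pr|rp|pr].
- have eTp : entry T p c i by rewrite /entry hr.
  by have := entry_row_inj kT eT eTp; lia.
- have [q rq eUq] := kt_inversion kU ij eUp eU rp.
  have eTq : entry T q c.+1 i by rewrite /entry hc.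
  by have := kt_descend kT eT eTq (ltnSn c); lia.
- by rewrite pr in eUp; have := entry_inj eU eUp; lia.
Qed.

Lemma part_le_sumn (a : seq nat) (i : nat) : part a i <= sumn a.
Proof.
rewrite /part; case: i => [|i] //=.
elim: a i => [|x a IH] [|i] //=; first exact: leq_addr.
by apply: leq_trans (IH i) _; exact: leq_addl.
Qed.

Lemma kt_diagram_inj (a : seq nat) (T U : filling) :
  kohnert_tableau a T -> kohnert_tableau a U -> domf T = domf U -> T = U.
Proof.
move=> kT kU dTU; apply/fmapP => -[r c].
(* No occupied column exceeds [sumn a], so the measure drops on passing to the next column on the
   right. Inside a column the induction goes upwards. *)
have [n] := ubnP ((sumn a).+1 - c); elim: n c r => // n IH c r hn.
elim/ltn_ind: r => r IHr.
case: (boolP ((r, c) \in domf T)) => hT; last first.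
  have hU : (r, c) \notin domf U by rewrite -dTU.
  by rewrite !not_fnd.
have hU : (r, c) \in domf U by rewrite -dTU.
have [i eT] := cell_entry hT; have [j eU] := cell_entry hU.
have cs : c <= sumn a.
  have := entry_column kT eT; have := part_le_sumn a i; lia.
have hc p : T.[? (p, c.+1)]%fmap = U.[? (p, c.+1)]%fmap by apply: IH; lia.
have hc' p : U.[? (p, c.+1)]%fmap = T.[? (p, c.+1)]%fmap by [].
have hr' p : p < r -> U.[? (p, c)]%fmap = T.[? (p, c)]%fmap by move=> /IHr.
have h1 := label_not_lt kT kU hc IHr eT eU.
have h2 := label_not_lt kU kT hc' hr' eU eT.
by rewrite eT eU; congr Some; lia.
Qed.

(** * Counting the cells of a column in the lowest rows *)

Definition support (a : seq nat) (c : nat) : {set 'I_(size a).+1} :=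
  [set e : 'I_(size a).+1 | c <= part a e].

Definition column (a : seq nat) (T : filling) (c : nat) :
    {set 'I_(size a).+1} :=
  [set r : 'I_(size a).+1 | (val r, c) \in domf T].

(** Rows and entries share the type ['I_(size a).+1], whose element 0 is neither a row nor an entry
    of a tableau; the lower bound discards it. *)
Definition upto (n p : nat) : {set 'I_n} := [set r : 'I_n | 0 < r <= p].

Definition row_of (a : seq nat) (T : filling) (c : nat)
    (e : 'I_(size a).+1) : 'I_(size a).+1 :=
  odflt ord0 [pick r : 'I_(size a).+1 | T.[? (val r, c)]%fmap == Some (val e)].

Lemma entry_row_of (a : seq nat) (T : filling) (c : nat)
    (e : 'I_(size a).+1) :
  kohnert_tableau a T -> 0 < c -> e \in support a c ->
  entry T (row_of T c e) c e.
Proof.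
rewrite inE => kT c0 he.
have [|r er] := @entry_exists a T c e kT; first by rewrite c0.
rewrite /row_of; case: pickP => [q /eqP //|] /= h.
have [_ re es _] := entry_range kT er.
have rs : r < (size a).+1 by lia.
by have := h (Ordinal rs); rewrite /= (er : _ = _) eqxx.
Qed.

Lemma row_of_inj (a : seq nat) (T : filling) (c : nat) :
  kohnert_tableau a T -> 0 < c ->
  {in support a c &, injective (@row_of a T c)}.
Proof.
move=> kT c0 e e' he he' E; apply: val_inj.
have h := entry_row_of kT c0 he; have h' := entry_row_of kT c0 he'.
by rewrite E in h; apply: entry_inj h h'.
Qed.

Lemma row_of_le (a : seq nat) (T : filling) (c : nat) (e : 'I_(size a).+1) :
  kohnert_tableau a T -> 0 < c -> e \in support a c -> row_of T c e <= e.
Proof. by move=> kT c0 he; exact: (kt_flag kT (entry_row_of kT c0 he)). Qed.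

Lemma row_of_column (a : seq nat) (T : filling) (c : nat)
    (e : 'I_(size a).+1) :
  kohnert_tableau a T -> 0 < c -> e \in support a c ->
  row_of T c e \in column a T c.
Proof.
by move=> kT c0 he; rewrite inE; apply: entry_cell (entry_row_of kT c0 he).
Qed.

Lemma card_column (a : seq nat) (T : filling) (c : nat) :
  kohnert_tableau a T -> 0 < c -> #|column a T c| = #|support a c|.
Proof.
move=> kT c0; rewrite -(card_in_imset (row_of_inj kT c0)).
apply: eq_card => r; apply/idP/imsetP => [|[e he ->]]; last first.
  exact: row_of_column.
rewrite inE => /cell_entry [e er].
have [_ _ es hc] := entry_range kT er.
have es' : e < (size a).+1 by lia.
have he : Ordinal es' \in support a c by rewrite inE /=; lia.
exists (Ordinal es') => //; apply: val_inj.
exact: entry_row_inj kT er (entry_row_of kT c0 he).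
Qed.

(** Both columns have as many cells as there are entries reaching column [c], and the cells above
    row [r] cancel. *)
Lemma column_upto_eq (a : seq nat) (T U : filling) (r c : nat) :
  kohnert_tableau a T -> kohnert_tableau a U -> 0 < c ->
  (forall p, r < p -> ((p, c) \in domf T) = ((p, c) \in domf U)) ->
  #|column a T c :&: upto (size a).+1 r| =
  #|column a U c :&: upto (size a).+1 r|.
Proof.
move=> kT kU c0 h.
have E : column a T c :\: upto (size a).+1 r =
         column a U c :\: upto (size a).+1 r.
  apply/setP => p; rewrite !inE.
  case: (ltnP 0 p) => p0 /=; first by case: (leqP p r) => //= /h ->.
  have Tp V : kohnert_tableau a V -> (val p, c) \notin domf V.
    by move=> kV; apply/negP => /(kt_cells kV) []; rewrite ltnNge p0.
  by rewrite (negbTE (Tp T kT)) (negbTE (Tp U kU)).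
have := cardsID (upto (size a).+1 r) (column a T c).
have := cardsID (upto (size a).+1 r) (column a U c).
by rewrite E (card_column kT c0) (card_column kU c0); lia.
Qed.

Lemma row_of_upto (a : seq nat) (T : filling) (c p : nat) :
  kohnert_tableau a T -> 0 < c ->
  [set row_of T c e | e in support a c :&: upto _ p]
    \subset column a T c :&: upto _ p.
Proof.
move=> kT c0; apply/subsetP => r /imsetP [e]; rewrite in_setI.
move=> /andP [he hp] ->.
rewrite in_setI row_of_column //= inE.
have [-> _ _ _] := entry_range kT (entry_row_of kT c0 he).
by have := row_of_le kT c0 he; rewrite inE in hp; lia.
Qed.

Lemma card_row_of_upto (a : seq nat) (T : filling) (c p : nat) :
  kohnert_tableau a T -> 0 < c ->
  #|[set row_of T c e | e in support a c :&: upto _ p]| =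
  #|support a c :&: upto _ p|.
Proof.
move=> kT c0; rewrite card_in_imset // => e e'.
by rewrite !in_setI => /andP [he _] /andP [he' _]; apply: row_of_inj.
Qed.

(** By the flag condition (ii), the entries at most [p] lie in distinct rows, none of them above row
    [p]. *)
Lemma support_upto_le (a : seq nat) (T : filling) (c p : nat) :
  kohnert_tableau a T -> 0 < c ->
  #|support a c :&: upto _ p| <= #|column a T c :&: upto _ p|.
Proof.
move=> kT c0; rewrite -(card_row_of_upto p kT c0).
exact/subset_leq_card/row_of_upto.
Qed.

(** The cell of [x] is one of those counted on the right, and no entry at most [p] occupies it. *)
Lemma support_upto_lt (a : seq nat) (T : filling) (q c p x : nat) :
  kohnert_tableau a T -> entry T q c x -> q <= p < x ->
  #|support a c :&: upto _ p| < #|column a T c :&: upto _ p|.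
Proof.
move=> kT e hp; have [q0 _ xs /andP [c0 hc]] := entry_range kT e.
rewrite -(card_row_of_upto p kT c0); apply: proper_card.
rewrite properE row_of_upto //=; apply/subsetPn.
have qs : q < (size a).+1 by lia.
exists (Ordinal qs).
  by rewrite !inE /= q0 (entry_cell e : is_true _); lia.
apply/negP => /imsetP [e']; rewrite in_setI => /andP [he' /=].
rewrite inE => hle Eq; have := entry_row_of kT c0 he'.
by rewrite -Eq /= => e''; have := entry_inj e e''; lia.
Qed.

Lemma column_upto_lt (a : seq nat) (T : filling) (r c : nat) :
  0 < r <= size a -> (r, c) \notin domf T ->
  #|column a T c :&: upto _ r| < #|upto (size a).+1 r|.
Proof.
move=> hr hn; apply: proper_card; rewrite properE subsetIr /=.
have rs : r < (size a).+1 by lia.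
by apply/subsetPn; exists (Ordinal rs); rewrite !inE /= ?(negbTE hn) //; lia.
Qed.

(** * Avoiding the three patterns implies multiplicity freeness *)

Definition avoids_a (a : seq nat) : Prop := forall i j k,
  0 < i -> i < j -> j < k -> k <= size a ->
  part a i < part a j -> part a j < part a k -> False.

Definition avoids_b (a : seq nat) : Prop := forall i j k l,
  0 < i -> i < j -> j < k -> k < l -> l <= size a ->
  part a i < part a l -> part a j < part a l -> part a l < part a k -> False.

Definition avoids_c (a : seq nat) : Prop := forall i j k l,
  0 < i -> i < j -> j < k -> k < l -> l <= size a ->
  part a i < part a k -> part a j + 1 < part a k -> part a k = part a l ->
  False.

(** Read in order of position, the two later parts give (a) together with [i] if they increase, (b)
    if they decrease and (c) if they are equal. In the last case [part a j < c < part a k] supplies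
    the gap that (c) asks for. *)
Lemma two_absent_two_present (a : seq nat) (c i j k l : nat) :
  avoids_a a -> avoids_b a -> avoids_c a ->
  0 < i -> i < j -> j < k -> j < l -> k <= size a -> l <= size a -> k <> l ->
  part a i < c -> part a j < c -> c < part a k -> c <= part a l -> False.
Proof.
move=> ha hb hc i0 ij jk jl ks ls nkl ic jc ck cl.
case: (ltngtP k l) => kl; last by [].
- case: (ltngtP (part a k) (part a l)) => kl'.
  + by apply: (ha i k l) => //; lia.
  + by apply: (hb i j k l) => //; lia.
  + by apply: (hc i j k l) => //; lia.
- case: (ltngtP (part a k) (part a l)) => kl'.
  + by apply: (hb i j l k) => //; lia.
  + by apply: (ha i l k) => //; lia.
  + by apply: (hc i j l k) => //; lia.
Qed.

(* In U, the entry x of cell (r, c') has come down from above row r, and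
   counting the cells of rows 1, ..., r in columns c and c' of T and U gives
   two parts before x too small to reach these columns; this ends up in a
   forbidden pattern. *)
Lemma no_crossing (a : seq nat) (T U : filling) (r c c' : nat) :
  avoids_a a -> avoids_b a -> avoids_c a ->
  kohnert_tableau a T -> kohnert_tableau a U ->
  (forall p d, r < p -> ((p, d) \in domf T) = ((p, d) \in domf U)) ->
  (r, c) \in domf T -> (r, c) \notin domf U ->
  (r, c') \in domf U -> (r, c') \notin domf T -> c < c' -> False.
Proof.
move=> ha hb hc kT kU above Tc Uc Uc' Tc' cc'.
have [x ex] := cell_entry Uc'; have [y ey] := cell_entry Tc.
have [r0 ry ys /andP [c0 hy]] := entry_range kT ey.
have [_ rx xs /andP [c'0 hx]] := entry_range kU ex.
have rs : r <= size a by lia.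
have [p ep] : exists p, entry U p c x by apply: (entry_exists kU); lia.
have rp : r < p.
  have := kt_descend kU ep ex cc'.
  case: (ltngtP r p) => // E; rewrite -E in ep.
  by rewrite (entry_cell ep : is_true _) in Uc.
have px : p <= x := kt_flag kU ep.
(* Like [U], [T] has fewer than [r] cells in rows 1, ..., [r] of column [c], and one of them is in
   row [r]. The rows below are too few to hold all of the entries 1, ..., [r.-1]. *)
have [i [i0 ir ic]] : exists i, [/\ 0 < i, i < r & part a i < c].
  have lt1 := column_upto_lt (a := a) (T := U) (introT andP (conj r0 rs)) Uc.
  rewrite -(column_upto_eq kT kU c0 (fun q => above q c)) in lt1.
  have rs' : r < (size a).+1 by [].
  pose ro := Ordinal rs'.
  have D (A : {set 'I_(size a).+1}) : ro \in A ->
      #|A :&: upto _ r| = (#|A :&: upto _ r.-1|).+1.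
    move=> hA; rewrite (cardsD1 ro) in_setI hA inE /= r0 leqnn add1n.
    congr _.+1; apply: eq_card => q; rewrite !inE -val_eqE /=.
    by case: (q \in A); rewrite ?andbF //=; lia.
  have hro : ro \in column a T c by rewrite inE.
  have := D _ hro; have := D setT (in_setT _); rewrite !setTI => E1 E2.
  have le1 := support_upto_le r.-1 kT c0.
  have : ~~ (upto (size a).+1 r.-1 \subset support a c :&: upto _ r.-1).
    by apply/negP => /subset_leq_card; lia.
  case/subsetPn => i; rewrite !inE => hi; rewrite hi andbT -ltnNge => hic.
  by exists i; split=> //; lia.
(* With two entries at most [r] absent from column [c], [x] would be the only later entry present
   there. As [T] also has the cell [(p, c)], it would contain [x] in both rows [r] and [p] of that
   column. *)
have only_i j : 0 < j -> j <= r -> j <> i -> c <= part a j.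
  move=> j0 jr ji; rewrite leqNgt; apply/negP => jc.
  have [m [n [m0 mn nr mc nc]]] :
      exists m n, [/\ 0 < m, m < n, n <= r, part a m < c & part a n < c].
    case: (ltngtP i j) => ij; [by exists i, j | | by case: ji].
    by exists j, i; split=> //; lia.
  have only_x w : n < w -> w <= size a -> c <= part a w -> w = x.
    move=> nw ws wc; case: (w =P x) => // wx.
    exfalso; apply: (@two_absent_two_present a c m n x w ha hb hc) => //; try lia.
  have yx : y = x.
    apply: only_x => //; case: (ltngtP n y) => // [|E]; first by lia.
    by rewrite -E in hy; lia.
  have [y' ey'] : exists y', entry T p c y'.
    by apply: cell_entry; rewrite /cell_in above //; apply: entry_cell ep.
  have [_ py' y's /andP [_ hy']] := entry_range kT ey'.
  have y'x : y' = x by apply: only_x => //; lia.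
  rewrite yx in ey; rewrite y'x in ey'.
  by have := entry_row_inj kT ey ey'; lia.
have rc : c <= part a r by apply: only_i => //; lia.
have xr : part a x <= part a r.
  by rewrite leqNgt; apply/negP => h; apply: (ha i r x) => //; lia.
(* Like [T], [U] has fewer than [r] cells in rows 1, ..., [r] of column [c'], and one of them holds
   [x > r]. So at least two entries at most [r] are absent from that column, and one of them may be
   chosen other than [i]. *)
have [z [z0 zr zi zc']] : exists z, [/\ 0 < z, z <= r, z <> i & part a z < c'].
  have lt1 := column_upto_lt (a := a) (T := T) (introT andP (conj r0 rs)) Tc'.
  rewrite (column_upto_eq kT kU c'0 (fun q => above q c')) in lt1.
  have lt2 : #|support a c' :&: upto _ r| < #|column a U c' :&: upto _ r|.
    by apply: (support_upto_lt kU ex); lia.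
  have is' : i < (size a).+1 by lia.
  pose io := Ordinal is'.
  have E : #|upto (size a).+1 r| = #|upto (size a).+1 r :\ io|.+1.
    by rewrite (cardsD1 io) inE /= i0 (ltnW ir).
  have : ~~ (upto (size a).+1 r :\ io \subset support a c' :&: upto _ r).
    by apply/negP => /subset_leq_card; lia.
  case/subsetPn => z; rewrite !inE -val_eqE /= => /andP [/eqP zi hz].
  by rewrite hz andbT -ltnNge => zc'; exists z; split=> //; lia.
have zc := only_i z z0 zr zi.
have zr' : z < r by case: (ltngtP z r) => // [|E]; [lia | rewrite E in zc'; lia].
(* If [i < z], then [i], [z], [x] form (a). Otherwise [z < i < r < x] form (b) or (c), according to
   whether [part a x] is less than or equal to [part a r]; the gap in (c) comes from
   [part a i < c < c']. *)
case: (ltngtP z i) => // [zi'|iz]; last by apply: (ha i z x) => //; lia.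
case: (ltngtP (part a x) (part a r)) => [xr'||E]; last 1 first.
- by apply: (hc z i r x) => //; lia.
- by apply: (hb z i r x) => //; lia.
- by lia.
Qed.

Lemma row_cell_exchange (T U : filling) (r c : nat) :
  count_row T r = count_row U r -> (r, c) \in domf T -> (r, c) \notin domf U ->
  exists2 c', (r, c') \in domf U & (r, c') \notin domf T.
Proof.
rewrite /count_row => E Tc Uc.
pose row (V : filling) := [fset x in domf V | x.1 == r]%fset.
have : ~~ (row U `<=` row T)%fset.
  apply/negP => /(fsubset_cardP (esym E)) h.
  by have := h (r, c); rewrite !inE /= Tc (negbTE Uc) eqxx.
case/fsubsetPn => -[r' c']; rewrite !inE /= => /andP [h /eqP r'r].
by rewrite r'r eqxx andbT in h * => h'; exists c'.
Qed.

Lemma row_agrees (a : seq nat) (T U : filling) (r c : nat) :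
  avoids_a a -> avoids_b a -> avoids_c a ->
  kohnert_tableau a T -> kohnert_tableau a U ->
  count_row T r = count_row U r ->
  (forall p d, r < p -> ((p, d) \in domf T) = ((p, d) \in domf U)) ->
  (r, c) \in domf T -> (r, c) \in domf U.
Proof.
move=> ha hb hc kT kU E above Tc; apply/negPn/negP => Uc.
have [c' Uc' Tc'] := row_cell_exchange E Tc Uc.
have above' p d : r < p -> ((p, d) \in domf U) = ((p, d) \in domf T).
  by move=> /above.
case: (ltngtP c c') => cc'.
- exact: (no_crossing ha hb hc kT kU above Tc Uc Uc' Tc').
- exact: (no_crossing ha hb hc kU kT above' Uc' Tc' Tc Uc).
- by rewrite -cc' Tc in Tc'.
Qed.

Lemma avoids_multiplicity_free (a : seq nat) :
  avoids_a a -> avoids_b a -> avoids_c a -> key_multiplicity_free a.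
Proof.
move=> ha hb hc T U [kT _] [kU _] wtTU.
have E r : 0 < r <= size a -> count_row T r = count_row U r.
  move=> hr; have := congr1 (fun s => nth 0 s r.-1) wtTU.
  have rs : r.-1 < size a by lia.
  by rewrite !(nth_map 0) ?size_iota // nth_iota // add1n prednK //; lia.
apply: (kt_diagram_inj kT kU); apply/fsetP => -[r c].
(* Rows are compared from the top down; above row [size a] both diagrams are empty. *)
have [n] := ubnP ((size a).+1 - r); elim: n r c => // n IH r c hn.
have above p d : r < p -> ((p, d) \in domf T) = ((p, d) \in domf U).
  move=> rp; case: (ltnP (size a) p) => hp; last by apply: IH; lia.
  have out V : kohnert_tableau a V -> (p, d) \notin domf V.
    by move=> kV; apply/negP => /cell_entry [i /(entry_range kV) []]; lia.
  by rewrite (negbTE (out T kT)) (negbTE (out U kU)).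
have above' p d : r < p -> ((p, d) \in domf U) = ((p, d) \in domf T).
  by move=> /above.
have inrow V : kohnert_tableau a V -> (r, c) \in domf V -> 0 < r <= size a.
  by move=> kV /cell_entry [i /(entry_range kV) []]; lia.
apply/idP/idP => h.
- have hr := inrow T kT h.
  exact: (row_agrees ha hb hc kT kU (E r hr) above h).
- have hr := inrow U kU h.
  exact: (row_agrees ha hb hc kU kT (esym (E r hr)) above' h).
Qed.

(** * Placements, their fillings and the straightening move *)

Definition positions (a : seq nat) : seq (nat * nat) :=
  [seq (c, i) | i <- iota 1 (size a), c <- iota 1 (part a i)].

(* f c i is the row of the entry i of column c; it is junk unless
   0 < c <= part a i. *)
Record placement (a : seq nat) (f : nat -> nat -> nat) : Prop := Placement {
  pl_gt0 : forall c i, 0 < c <= part a i -> 0 < f c i;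
  pl_flag : forall c i, 0 < c <= part a i -> f c i <= i;
  pl_inj : forall c i j, 0 < c <= part a i -> 0 < c <= part a j ->
    f c i = f c j -> i = j;
  pl_descend : forall c i, 0 < c < part a i -> f c.+1 i <= f c i
}.

(** Condition (iv), the only one that the filling of a placement may fail; [c < part a i] says that
    [i] does occur in column [c.+1]. *)
Definition kohnert_placement (a : seq nat) (f : nat -> nat -> nat) : Prop :=
  forall c i j, i < j -> 0 < c <= part a i -> 0 < c <= part a j ->
    f c j < f c i -> c < part a i /\ f c j < f c.+1 i.

Definition cells (a : seq nat) (f : nat -> nat -> nat) : seq (nat * nat) :=
  [seq (f x.1 x.2, x.1) | x <- positions a].

(** Listing the candidates from 0 makes the position returned by [find] the entry itself. *)
Definition label (a : seq nat) (f : nat -> nat -> nat) (x : nat * nat) : nat :=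
  find (fun i => (x.2 <= part a i) && (f x.2 i == x.1)) (iota 0 (size a).+1).

Definition filling_of (a : seq nat) (f : nat -> nat -> nat) : filling :=
  [fmap x : seq_fset tt (cells a f) => label a f (val x)]%fmap.

Lemma mem_positions (a : seq nat) (c i : nat) :
  ((c, i) \in positions a) = (0 < c <= part a i).
Proof.
apply/allpairsPdep/idP => [[j [d [hj hd [-> ->]]]]|h].
  by rewrite mem_iota in hd; lia.
have [|i0 hi] := @part_gt0_size a i; first by lia.
by exists i, c; rewrite !mem_iota; split=> //; lia.
Qed.

Lemma positions_uniq (a : seq nat) : uniq (positions a).
Proof.
apply: allpairs_uniq_dep => [|i _|]; rewrite ?iota_uniq //.
by move=> [i c] [j d] /= _ _ [-> ->].
Qed.

Lemma cellsP (a : seq nat) (f : nat -> nat -> nat) (r c : nat) :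
  reflect (exists2 i, 0 < c <= part a i & f c i = r) ((r, c) \in cells a f).
Proof.
apply: (iffP mapP) => [[[d i]]|[i hi <-]]; last first.
  by exists (c, i); rewrite ?mem_positions.
by rewrite mem_positions => hi [-> ->]; exists i.
Qed.

Lemma cells_uniq (a : seq nat) (f : nat -> nat -> nat) :
  placement a f -> uniq (cells a f).
Proof.
move=> pf; rewrite map_inj_in_uniq ?positions_uniq // => -[c i] [d j].
rewrite !mem_positions /= => hi hj [E cd]; rewrite -cd in hj E *.
by rewrite (pl_inj pf hi hj E).
Qed.

Lemma card_fset_seq (K : choiceType) (A : {fset K}) (s : seq K) :
  uniq s -> A =i s -> #|` A|%fset = size s.
Proof. by move=> us E; apply: perm_size; apply: uniq_perm. Qed.

Lemma domf_filling_of (a : seq nat) (f : nat -> nat -> nat) :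
  domf (filling_of a f) =i cells a f.
Proof. by move=> x; rewrite seq_fsetE. Qed.

Lemma label_eq (a : seq nat) (f : nat -> nat -> nat) (c i : nat) :
  placement a f -> 0 < c <= part a i -> label a f (f c i, c) = i.
Proof.
move=> pf hi; rewrite /label /=.
set P := fun j => _; have [|_ si] := @part_gt0_size a i; first by lia.
have hP : has P (iota 0 (size a).+1).
  apply/hasP; exists i; first by rewrite mem_iota; lia.
  by rewrite /P eqxx andbT; lia.
have := nth_find 0 hP; rewrite nth_iota; last first.
  by rewrite -[X in _ < X](size_iota 0) -has_find.
rewrite add0n => /andP [h /eqP E].
by apply: (pl_inj pf _ hi E); lia.
Qed.

Lemma entry_filling_of (a : seq nat) (f : nat -> nat -> nat) (r c i : nat) :
  placement a f ->
  entry (filling_of a f) r c i <-> 0 < c <= part a i /\ f c i = r.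
Proof.
move=> pf; rewrite /entry; split.
  case: fndP => // h; rewrite ffunE /= => -[].
  have := h; rewrite domf_filling_of => /cellsP [j hj <-].
  by rewrite label_eq // => <-.
move=> [hi <-]; case: fndP => [h|]; first by rewrite ffunE /= label_eq.
by rewrite domf_filling_of => /cellsP []; exists i.
Qed.

Lemma kohnert_filling_of (a : seq nat) (f : nat -> nat -> nat) :
  placement a f -> kohnert_placement a f ->
  kohnert_tableau a (filling_of a f).
Proof.
move=> pf kf; have E r c i := entry_filling_of r c i pf.
split.
- move=> r c /cell_entry [i /E [hi <-]]; split; last by lia.
  exact: (pl_gt0 pf).
- by move=> r c i /E [hi _]; have [|] := @part_gt0_size a i; lia.
- move=> i i0; rewrite /count_entry.
  rewrite -[RHS](size_iota 1) -(size_map (fun c => (f c i, c))).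
  apply: card_fset_seq => [|[r c]].
    by rewrite map_inj_uniq ?iota_uniq // => c d [].
  rewrite !inE /=; apply/andP/mapP => [[_ /eqP /E [hi <-]]|[d hd [-> ->]]].
    by exists c; rewrite // mem_iota; lia.
  have e : entry (filling_of a f) (f d i) d i.
    by apply/E; rewrite mem_iota in hd; split=> //; lia.
  by split; [apply: entry_cell e | apply/eqP].
- move=> i c i0 hc; exists (f c i); split; first by apply/E.
  by move=> r /E [].
- by move=> r c i /E [hi <-]; exact: (pl_flag pf).
- move=> i r c r' c' /E [hc <-] /E [hc' <-].
  elim: c' hc' => // c' IH hc'; rewrite ltnS leq_eqVlt => /orP [/eqP cc'|lt].
    by rewrite -cc' in hc' *; apply: (pl_descend pf); lia.
  by apply: leq_trans (IH _ lt); [apply: (pl_descend pf)|]; lia.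
- move=> i j r r' c ij /E [hi <-] /E [hj <-] lt.
  have [h1 h2] := kf c i j ij hi hj lt.
  by exists (f c.+1 i) => //; apply/E; split=> //; lia.
Qed.

Lemma count_row_filling_of (a : seq nat) (f : nat -> nat -> nat) (r : nat) :
  placement a f ->
  count_row (filling_of a f) r =
  \sum_(x <- positions a) (f x.1 x.2 == r).
Proof.
move=> pf; rewrite /count_row.
rewrite (@card_fset_seq _ _ (filter (fun x => x.1 == r) (cells a f))).
- by rewrite /cells filter_map size_map size_filter -sum1_count big_mkcond.
- by rewrite filter_uniq ?cells_uniq.
- by move=> x; rewrite !inE mem_filter domf_filling_of andbC.
Qed.

(* When i < j violate kohnert_placement in column c, giving i the lower and j
   the higher of their two rows in all columns up to c keeps the diagram and
   increases the potential below. *)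
Definition bump (f : nat -> nat -> nat) (c i j : nat) : nat -> nat -> nat :=
  fun d e =>
    if d <= c then
      if e == i then minn (f d i) (f d j)
      else if e == j then maxn (f d i) (f d j) else f d e
    else f d e.

Lemma bump_minmax (f : nat -> nat -> nat) (c i j d : nat) :
  i < j -> d <= c ->
  bump f c i j d i = minn (f d i) (f d j) /\
  bump f c i j d j = maxn (f d i) (f d j).
Proof.
by move=> ij dc; rewrite /bump dc !eqxx; split=> //; case: eqP => //; lia.
Qed.

Lemma bump_other (f : nat -> nat -> nat) (c i j d e : nat) :
  c < d \/ e <> i /\ e <> j -> bump f c i j d e = f d e.
Proof.
rewrite /bump; case=> [cd|[/eqP/negbTE -> /eqP/negbTE ->]]; last by case: ifP.
by rewrite leqNgt cd.
Qed.

Variant bump_spec (f : nat -> nat -> nat) (c i j d e : nat) : nat -> Prop :=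
| BumpMin of d <= c & e = i : bump_spec f c i j d e (minn (f d i) (f d j))
| BumpMax of d <= c & e = j : bump_spec f c i j d e (maxn (f d i) (f d j))
| BumpOther of c < d \/ e <> i /\ e <> j : bump_spec f c i j d e (f d e).

Lemma bumpP (f : nat -> nat -> nat) (c i j d e : nat) :
  bump_spec f c i j d e (bump f c i j d e).
Proof.
rewrite /bump; case: (leqP d c) => dc; last by constructor; left.
case: eqP => ei; first by constructor.
by case: eqP => ej; constructor=> //; right.
Qed.

(** In each column the move acts on entries as the identity or as the transposition of [i] and [j],
    which both reach column [c]. Injectivity and invariance of the diagram both follow from this
    form. *)
Lemma bump_perm (a : seq nat) (f : nat -> nat -> nat) (c i j d : nat) :
  i < j -> c <= part a i -> c <= part a j ->
  exists t : nat -> nat, [/\ involutive t,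
    forall e, (d <= part a (t e)) = (d <= part a e) &
    forall e, bump f c i j d e = f d (t e)].
Proof.
move=> ij hi hj; case: (leqP d c) => dc; last first.
  by exists id; split=> // e; rewrite bump_other //; left.
have [Ei Ej] := bump_minmax f ij dc.
case: (leqP (f d i) (f d j)) => le.
  exists id; split=> // e; case: (bumpP f c i j d e) => // _ ->.
    exact/minn_idPl.
  exact/maxn_idPr.
exists (fun e => if e == i then j else if e == j then i else e).
have ji : (j == i) = false by apply/eqP; lia.
split=> e.
- case: (e =P i) => [->|/eqP/negbTE ei]; first by rewrite ji eqxx.
  by case: (e =P j) => [->|/eqP/negbTE ej]; rewrite ?eqxx ?ei ?ej.
- by case: (e =P i) => [->|_]; [|case: (e =P j) => [->|//]]; lia.
- case: (bumpP f c i j d e) => [_ ->|_ ->|[|[/eqP/negbTE -> /eqP/negbTE ->]]] //.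
  + by rewrite eqxx; apply/minn_idPr; lia.
  + by rewrite ji eqxx; apply/maxn_idPl; lia.
  + by lia.
Qed.

(** Minimum and maximum preserve descent up to column [c]. From [c] to [c.+1] only [i] is at risk,
    and the violation of (iv) says that [i] ends in column [c] or lies no higher than [f c j] in
    column [c.+1]. *)
Lemma bump_placement (a : seq nat) (f : nat -> nat -> nat) (c i j : nat) :
  placement a f -> i < j -> 0 < c <= part a i -> 0 < c <= part a j ->
  ~ (c < part a i /\ f c j < f c.+1 i) -> placement a (bump f c i j).
Proof.
move=> pf ij hi hj viol.
have act d : 0 < d -> d <= c -> [/\ 0 < f d i, 0 < f d j, f d i <= i, f d j <= j
    & f d i <> f d j].
  move=> d0 dc; have [ai aj] : 0 < d <= part a i /\ 0 < d <= part a j by lia.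
  split; try exact: (pl_gt0 pf); try exact: (pl_flag pf).
  by move/(pl_inj pf ai aj); lia.
split.
- move=> d e he; case: bumpP => *; last exact: (pl_gt0 pf).
    by have [] := act d; lia.
  by have [] := act d; lia.
- move=> d e he; case: bumpP => *; last exact: (pl_flag pf).
    by have [] := act d; lia.
  by have [] := act d; lia.
- move=> d e e' he he'.
  have [||t [tK te E]] := @bump_perm a f c i j d ij; [lia | lia |].
  rewrite !E => /(pl_inj pf).
  by rewrite !te => /(_ he he') /(can_inj tK).
- move=> d e he.
  have de := pl_descend pf he.
  have di : d < c -> f d.+1 i <= f d i by move=> dc; apply: (pl_descend pf); lia.
  have dj : d < c -> f d.+1 j <= f d j by move=> dc; apply: (pl_descend pf); lia.
  have last_i : d = c -> e = i -> f d.+1 i <= f d j.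
    move=> dc ei; subst d e; rewrite leqNgt; apply/negP => h; apply: viol.
    by split=> //; lia.
  by case: (bumpP f c i j d.+1 e); case: (bumpP f c i j d e); intros; subst; lia.
Qed.

Lemma bump_cells (a : seq nat) (f : nat -> nat -> nat) (c i j : nat) :
  i < j -> 0 < c <= part a i -> 0 < c <= part a j ->
  cells a (bump f c i j) =i cells a f.
Proof.
move=> ij hi hj -[r d].
have [||t [tK te E]] := @bump_perm a f c i j d ij; [lia | lia |].
apply/cellsP/cellsP => -[e he <-]; exists (t e); rewrite ?te ?E ?tK //.
Qed.

(** * Termination of the straightening *)

Definition potential (a : seq nat) (f : nat -> nat -> nat) : nat :=
  \sum_(e < (size a).+1) e * \sum_(1 <= d < (part a e).+1) f d e.

Lemma potential_le (a : seq nat) (f : nat -> nat -> nat) :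
  placement a f -> potential a f <= potential a (fun _ i => i).
Proof.
move=> pf; apply: leq_sum => e _; rewrite leq_mul2l; apply/orP; right.
rewrite big_nat [leqRHS]big_nat; apply: leq_sum => d hd.
by apply: (pl_flag pf); lia.
Qed.

(** The rows of [i] and [j] keep their total, while the share of [i] strictly decreases because of
    column [c]; as [i < j], the sum weighted by entries grows. *)
Lemma potential_bump (a : seq nat) (f : nat -> nat -> nat) (c i j : nat) :
  i < j -> 0 < c <= part a i -> 0 < c <= part a j -> f c j < f c i ->
  potential a f < potential a (bump f c i j).
Proof.
move=> ij hi hj lt.
have [|_ si] := @part_gt0_size a i; first by lia.
have [|_ sj] := @part_gt0_size a j; first by lia.
have si' : i < (size a).+1 by [].
have sj' : j < (size a).+1 by [].
pose g := bump f c i j.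
have other (e : nat) : e <> i -> e <> j ->
    \sum_(1 <= d < (part a e).+1) g d e = \sum_(1 <= d < (part a e).+1) f d e.
  by move=> ei ej; apply: eq_bigr => d _; rewrite /g bump_other //; right.
have splitc (h : nat -> nat -> nat) e : c <= part a e ->
    \sum_(1 <= d < (part a e).+1) h d e =
    \sum_(1 <= d < c.+1) h d e + \sum_(c.+1 <= d < (part a e).+1) h d e.
  by move=> ce; rewrite (big_cat_nat _ (n := c.+1)).
have tail e : \sum_(c.+1 <= d < (part a e).+1) g d e =
              \sum_(c.+1 <= d < (part a e).+1) f d e.
  by apply: eq_big_nat => d hd; rewrite /g bump_other //; left; lia.
have headi : \sum_(1 <= d < c.+1) g d i =
    \sum_(1 <= d < c.+1) minn (f d i) (f d j).
  apply: eq_big_nat => d hd; rewrite /g.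
  by have [|-> _] := @bump_minmax f c i j d ij; first by lia.
have headj : \sum_(1 <= d < c.+1) g d j =
    \sum_(1 <= d < c.+1) maxn (f d i) (f d j).
  apply: eq_big_nat => d hd; rewrite /g.
  by have [|_ ->] := @bump_minmax f c i j d ij; first by lia.
have sum_eq : \sum_(1 <= d < c.+1) g d i + \sum_(1 <= d < c.+1) g d j =
    \sum_(1 <= d < c.+1) f d i + \sum_(1 <= d < c.+1) f d j.
  by rewrite headi headj -!big_split; apply: eq_bigr => d _; rewrite /=; lia.
have sum_lt : \sum_(1 <= d < c.+1) g d i < \sum_(1 <= d < c.+1) f d i.
  rewrite headi !big_nat_recr /=; try lia.
  have : \sum_(1 <= d < c) minn (f d i) (f d j) <= \sum_(1 <= d < c) f d i.
    by apply: leq_sum => d _; lia.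
  by lia.
rewrite /potential -/g.
rewrite (bigD1 (Ordinal si')) //= (bigD1 (Ordinal sj')) /=; last first.
  by rewrite -val_eqE /=; lia.
rewrite [ltnRHS](bigD1 (Ordinal si')) //=.
rewrite [X in _ < _ + X](bigD1 (Ordinal sj')) /=; last first.
  by rewrite -val_eqE /=; lia.
set X := \sum_(_ < _ | _) _; set Y := \sum_(_ < _ | _) _.
have -> : Y = X.
  apply: eq_bigr => e; rewrite -!val_eqE /= => /andP [/eqP ei /eqP ej].
  by rewrite other.
rewrite !splitc ?tail; try lia.
by nia.
Qed.

Lemma straighten (a : seq nat) (f : nat -> nat -> nat) :
  placement a f ->
  exists g, [/\ placement a g, kohnert_placement a g & cells a g =i cells a f].
Proof.
have [n] := ubnP (potential a (fun _ i => i) - potential a f).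
elim: n f => // n IH f hn pf.
pose ok (c i j : nat) := [&& i < j, 0 < c <= part a i, 0 < c <= part a j &
  f c j < f c i] ==> (c < part a i) && (f c j < f c.+1 i).
(* Bounded quantifiers make the existence of a violation decidable: no entry exceeds [size a] and no
   occupied column exceeds [sumn a]. *)
case: (boolP [forall c : 'I_(sumn a).+1, forall i : 'I_(size a).+1,
              forall j : 'I_(size a).+1, ok c i j]) => [/forallP h|].
  exists f; split=> // c i j ij hi hj lt.
  have [|_ si] := @part_gt0_size a i; first by lia.
  have [|_ sj] := @part_gt0_size a j; first by lia.
  have sc : c < (sumn a).+1 by have := part_le_sumn a i; lia.
  have /forallP/(_ (Ordinal (si : i < (size a).+1))) := h (Ordinal sc).
  move=> /forallP/(_ (Ordinal (sj : j < (size a).+1))); rewrite /ok /=.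
  by rewrite ij hi hj lt /= => /andP.
rewrite negb_forall => /existsP [c]; rewrite negb_forall => /existsP [i].
rewrite negb_forall => /existsP [j]; rewrite /ok negb_imply.
move=> /andP [/and4P [ij hi hj lt] /andP viol].
have lt' := potential_bump ij hi hj lt.
have pg := bump_placement pf ij hi hj viol.
have [|g [pg' kg E]] := IH (bump f c i j) _ pg.
  by have := potential_le pg; lia.
by exists g; split=> // x; rewrite E bump_cells.
Qed.

(** * The quasi-Yamanouchi condition for strong compositions *)

Lemma entry_diagonal (a : seq nat) (T : filling) (i : nat) :
  strong_comp a -> kohnert_tableau a T -> 0 < i <= size a -> entry T i 1 i.
Proof.
move=> sa kT; elim/ltn_ind: i => i IH hi.
have pos k : 0 < k <= size a -> 0 < 1 <= part a k.
  case: k => // k hk; rewrite /part /=.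
  have ks : k < size a by lia.
  exact: (allP sa _ (mem_nth 0 ks)).
have [r er] := entry_exists kT (pos i hi).
have [r0 ri _ _] := entry_range kT er.
move: ri; rewrite leq_eqVlt => /orP [/eqP ri|ri]; first by rewrite {1}ri in er.
have hr : 0 < r <= size a by lia.
(* By induction, a row [r < i] of column 1 is already taken by the entry [r]. *)
by have := entry_inj er (IH r ri hr); lia.
Qed.

Lemma kt_quasi_yamanouchi (a : seq nat) (T : filling) :
  strong_comp a -> kohnert_tableau a T -> quasi_yamanouchi T.
Proof.
move=> sa kT r [c /cell_entry [i e]]; left; exists 1.
by have [? ? ? _] := entry_range kT e; apply: (entry_diagonal sa kT); lia.
Qed.

(** * Distinct tableaux of equal weight from each pattern *)

Definition exchange (f : nat -> nat -> nat) (c1 e1 c2 e2 : nat) :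
    nat -> nat -> nat :=
  fun c e => if (c == c1) && (e == e1) then f c2 e2
             else if (c == c2) && (e == e2) then f c1 e1 else f c e.

Lemma row_sum_exchange (a : seq nat) (f : nat -> nat -> nat)
    (c1 e1 c2 e2 r : nat) :
  c1 <> c2 -> 0 < c1 <= part a e1 -> 0 < c2 <= part a e2 ->
  \sum_(x <- positions a) (exchange f c1 e1 c2 e2 x.1 x.2 == r) =
  \sum_(x <- positions a) (f x.1 x.2 == r).
Proof.
move=> /eqP/negbTE c12 h1 h2; have u := positions_uniq a.
have m1 : (c1, e1) \in positions a by rewrite mem_positions.
have m2 : (c2, e2) \in rem (c1, e1) (positions a).
  by rewrite (mem_rem_uniq _ u) !inE mem_positions h2 xpair_eqE eq_sym c12.
rewrite !(big_rem _ m1) !(big_rem _ m2) /= !addnA; congr (_ + _).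
  by rewrite /exchange !eqxx [c2 == c1]eq_sym c12 /= addnC.
apply: eq_big_seq => -[c e] /=.
rewrite (mem_rem_uniq _ (rem_uniq _ u)) inE => /andP [n2].
rewrite (mem_rem_uniq _ u) inE => /andP [n1 _].
rewrite !xpair_eqE in n1 n2.
by rewrite /exchange (negbTE n1) (negbTE n2).
Qed.

(** Both placements are straightened, which keeps their diagrams. The second diagram lacks the cell
    [(f c1 e1, c1)]: [e1] has left it, and by injectivity no other entry of column [c1] lies
    there. *)
Lemma exchange_not_free (a : seq nat) (f : nat -> nat -> nat)
    (c1 e1 c2 e2 : nat) :
  strong_comp a -> placement a f -> placement a (exchange f c1 e1 c2 e2) ->
  c1 <> c2 -> 0 < c1 <= part a e1 -> 0 < c2 <= part a e2 ->
  f c1 e1 <> f c2 e2 -> ~ key_multiplicity_free a.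
Proof.
move=> sa pf pg c12 h1 h2 ne mf.
set g := exchange _ _ _ _ _ in pg.
have [f' [pf' kf' Ef]] := straighten pf.
have [g' [pg' kg' Eg]] := straighten pg.
have kT := kohnert_filling_of pf' kf'; have kU := kohnert_filling_of pg' kg'.
have wrow h h' r : placement a h -> placement a h' -> cells a h' =i cells a h ->
    count_row (filling_of a h') r = \sum_(x <- positions a) (h x.1 x.2 == r).
  move=> ph ph' E; rewrite -count_row_filling_of // /count_row.
  congr #|` _|%fset; apply/fsetP => x.
  by rewrite !inE !domf_filling_of E.
have TU : filling_of a f' = filling_of a g'.
  apply: mf; [by split; last exact: kt_quasi_yamanouchi kT
             | by split; last exact: kt_quasi_yamanouchi kU |].
  rewrite /wt; apply: eq_map => r.
  by rewrite (wrow f) // (wrow g) // /g row_sum_exchange.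
have : (f c1 e1, c1) \in cells a g.
  rewrite -Eg -domf_filling_of -TU domf_filling_of Ef.
  by apply/cellsP; exists e1.
case/cellsP => e he; rewrite /g /exchange eqxx /=.
case: (e =P e1) => [ee1 E|ee1]; first by apply: ne.
have -> /= : (c1 == c2) = false by apply/eqP.
by move/(pl_inj pf he h1).
Qed.

Definition update (f : nat -> nat -> nat) (c e r : nat) : nat -> nat -> nat :=
  fun d x => if (d == c) && (x == e) then r else f d x.

Lemma entry_gt0 (a : seq nat) (c i : nat) : 0 < c <= part a i -> 0 < i.
Proof. by move=> h; have [] := @part_gt0_size a i; first by lia. Qed.

Ltac eq_cases :=
  rewrite /exchange /update;
  repeat match goal with
    |- context [?u == ?v] => case: (u =P v) => ?; subst; rewrite /=
  end; try solve [lia | move=> ?; subst; lia].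

(** Positivity of the entry is recorded for the first goal, since an entry that has not been moved
    lies in the row of its own number. *)
Ltac check_placement :=
  split; [ move=> c x /[dup] /entry_gt0 x0 hx | move=> c x hx
         | move=> c x y hx hy | move=> c x hx ]; eq_cases.

(** The last cells of [j] and [k] occupy rows [j] and [i], then rows [i] and [j]. Row [i] is free in
    both columns and row [j] in the last column of [k]; a last cell has no successor that could
    break descent. *)
Lemma pattern_a_not_free (a : seq nat) (i j k : nat) :
  strong_comp a -> 0 < i -> i < j -> j < k ->
  part a i < part a j -> part a j < part a k -> ~ key_multiplicity_free a.
Proof.
move=> sa i0 ij jk ij' jk'.
pose f := update (fun _ x => x) (part a k) k i.
apply: (@exchange_not_free a f (part a j) j (part a k) k) => //; try lia.
- by rewrite /f; clear f; check_placement.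
- by rewrite /f; clear f; check_placement.
- by rewrite /f; clear f; eq_cases.
Qed.

(** The last cells of [k] and [l] lie in different columns, which neither [i] nor [j] reaches; they
    take rows [i] and [j] in either order. *)
Lemma pattern_b_not_free (a : seq nat) (i j k l : nat) :
  strong_comp a -> 0 < i -> i < j -> j < k -> k < l ->
  part a i < part a l -> part a j < part a l -> part a l < part a k ->
  ~ key_multiplicity_free a.
Proof.
move=> sa i0 ij jk kl il jl lk.
pose f := update (update (fun _ x => x) (part a k) k i) (part a l) l j.
apply: (@exchange_not_free a f (part a l) l (part a k) k) => //; try lia.
- by rewrite /f; clear f; check_placement.
- by rewrite /f; clear f; check_placement.
- by rewrite /f; clear f; eq_cases.
Qed.

(** In the last column [m.+1] of [k] and [l], [k] moves to row [i] and so frees row [k]. The cell of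
    [k] in column [m] and that of [l] in column [m.+1] then share rows [j] and [k] in either order.
    The gap in (c) keeps [j] out of column [m]; [i] may reach it, so row [i] is used in column
    [m.+1] only. *)
Lemma pattern_c_not_free (a : seq nat) (i j k l : nat) :
  strong_comp a -> 0 < i -> i < j -> j < k -> k < l ->
  part a i < part a k -> part a j + 1 < part a k -> part a k = part a l ->
  ~ key_multiplicity_free a.
Proof.
move=> sa i0 ij jk kl ik jk' kl'; have [m Em] : exists m, m.+1 = part a k.
  by exists (part a k).-1; lia.
pose f := update (update (update (fun _ x => x) m k j) m.+1 k i) m.+1 l k.
apply: (@exchange_not_free a f m k m.+1 l) => //; try lia.
- by rewrite /f; clear f; check_placement.
- by rewrite /f; clear f; check_placement.
- by rewrite /f; clear f; eq_cases.
Qed.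

Theorem theorem4p3 (alpha : seq nat) (halpha : strong_comp alpha) :
  key_multiplicity_free alpha <->
  [/\ ~ (exists i j k : nat,
           [/\ 1 <= i, i < j, j < k & k <= size alpha] /\
           part alpha i < part alpha j /\ part alpha j < part alpha k),
      ~ (exists i j k l : nat,
           [/\ 1 <= i, i < j, j < k, k < l & l <= size alpha] /\
           [/\ part alpha i < part alpha l,
               part alpha j < part alpha l &
               part alpha l < part alpha k])
    & ~ (exists i j k l : nat,
           [/\ 1 <= i, i < j, j < k, k < l & l <= size alpha] /\
           [/\ part alpha i < part alpha k,
               part alpha j + 1 < part alpha k &
               part alpha k = part alpha l])].
Proof.
split=> [mf|[ha hb hc]].
  split.
  - by move=> [i [j [k [[i0 ij jk _] [h1 h2]]]]];
      apply: (pattern_a_not_free halpha i0 ij jk).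
  - by move=> [i [j [k [l [[i0 ij jk kl _] [h1 h2 h3]]]]]];
      apply: (pattern_b_not_free halpha i0 ij jk kl).
  - by move=> [i [j [k [l [[i0 ij jk kl _] [h1 h2 h3]]]]]];
      apply: (pattern_c_not_free halpha i0 ij jk kl).
apply: avoids_multiplicity_free => i j k.
- by move=> *; apply: ha; exists i, j, k.
- by move=> l *; apply: hb; exists i, j, k, l.
- by move=> l *; apply: hc; exists i, j, k, l.
Qed.
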